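(* The Banach space $\ell^1$ does not embed isomorphically in the James Tree Space $\mathcal{JT}$; that is, there is no linear map $T:\ell^1\to\mathcal{JT}$ which is an isomorphism (linear homeomorphism) onto its image.
   Context: All vector spaces are over $\mathbb{R}$. The Cantor tree $2^{<\mathbb{N}}$ is the set of all finite sequences (including the empty sequence $\emptyset$) with entries in $\{0,1\}$; its elements are called nodes. For $s,t\in 2^{<\mathbb{N}}$, $s\sqsubseteq t$ means that $s$ is an initial segment of $t$ (in particular $\emptyset\sqsubseteq t$ for every $t$). An interval is a set $I\subseteq 2^{<\mathbb{N}}$ which is totally ordered by $\sqsubseteq$ and such that $s\sqsubseteq w\sqsubseteq t$ with $s,t\in I$ and $w\in 2^{<\mathbb{N}}$ implies $w\in I$. A finite interval is called a segment. The James Tree Space is $$\mathcal{JT}=\Big\{x:2^{<\mathbb{N}}\to\mathbb{R}\;:\;\sup\sum_{i=1}^m\Big|\sum_{s\in F_i}x_s\Big|^2<\infty\Big\},\qquad \|x\|=\Big(\sup\sum_{i=1}^m\Big|\sum_{s\in F_i}x_s\Big|^2\Big)^{1/2},$$ where the suprema are taken over all $m\in\mathbb{N}$ and all finite families $\{F_i\}_{i=1}^m$ of pairwise disjoint segments. *)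

(* Defs.v *)
From HB Require Import structures.
From mathcomp Require Import all_boot all_order all_algebra.
From mathcomp Require Import ring.
From mathcomp Require Import all_classical reals ereal topology normedtype.
From mathcomp Require Import sequences.

Set Implicit Arguments.
Unset Strict Implicit.
Unset Printing Implicit Defensive.

Import Order.TTheory GRing.Theory Num.Theory.
Import numFieldNormedType.Exports.

Local Open Scope classical_set_scope.
Local Open Scope ring_scope.

Notation node := (seq bool).

Definition tree_interval (I : set node) :=
  (forall s t, I s -> I t -> prefix s t \/ prefix t s) /\
  (forall s w t, I s -> I t -> prefix s w -> prefix w t -> I w).

(* The empty set is a segment; it contributes 0 to every sum below. *)
Definition tree_segment (I : set node) := tree_interval I /\ finite_set I.

Lemma tree_segment1 (s : node) : tree_segment [set s].
Proof.
split; last exact: finite_set1.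
split=> [_ _ -> ->|_ w _ -> ->]; first by left; exact: prefix_refl.
move=> /prefixP[u ->] /prefixP[v] /(congr1 size).
rewrite !size_cat -addnA -[LHS]addn0 => /addnI /esym/eqP.
by rewrite addn_eq0 size_eq0 => /andP[/eqP -> _]; rewrite cats0.
Qed.

Section JamesTree.
Variable R : realType.
Implicit Types (x y : node -> R) (a b : R).

Definition jt_sum x (m : nat) (F : 'I_m -> set node) : R :=
  \sum_(i < m) `| \sum_(s \in F i) x s | ^+ 2.

Definition jt_sup x : \bar R :=
  ereal_sup [set e | exists (m : nat) (F : 'I_m -> set node),
    [/\ forall i, tree_segment (F i), trivIset setT F & e = (jt_sum x F)%:E]].

Definition jt_norm x : R := Num.sqrt (fine (jt_sup x)).

Definition jt_pred : {pred (node -> R)} := mem [set x | (jt_sup x < +oo)%E].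

Lemma jt_predP x : reflect (jt_sup x < +oo)%E (x \in jt_pred).
Proof. by apply: (iffP idP) => [/set_mem|/mem_set]. Qed.

Lemma jt_sum_ge0 x m (F : 'I_m -> set node) : 0 <= jt_sum x F.
Proof. by apply: sumr_ge0 => i _; rewrite exprn_ge0. Qed.

Lemma jt_sup_ge x m (F : 'I_m -> set node) :
  (forall i, tree_segment (F i)) -> trivIset setT F ->
  ((jt_sum x F)%:E <= jt_sup x)%E.
Proof. by move=> sF tF; apply: ereal_sup_ubound; exists m, F. Qed.

Lemma jt_sup_le x (c : \bar R) :
  (forall m (F : 'I_m -> set node), (forall i, tree_segment (F i)) ->
    trivIset setT F -> ((jt_sum x F)%:E <= c)%E) ->
  (jt_sup x <= c)%E.
Proof. by move=> h; apply: ge_ereal_sup => _ [m [F [sF tF ->]]]; exact: h. Qed.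

Lemma jt_sup_ge0 x : (0 <= jt_sup x)%E.
Proof.
have F0 : 'I_0 -> set node by case.
apply: le_trans (@jt_sup_ge x 0%N F0 _ _); first by rewrite lee_fin jt_sum_ge0.
  by case.
by case.
Qed.

Lemma jt_sup_eq0 x : jt_sup x = 0%E -> x = 0.
Proof.
move=> x0; apply/funext => s.
have := @jt_sup_ge x 1%N (fun=> [set s]) (fun=> tree_segment1 s).
rewrite x0 lee_fin /jt_sum big_ord1 fsbig_set1 => /(_ _)/wrap[].
  by move=> i j _ _ _; rewrite !ord1.
move=> xs; have : `|x s| ^+ 2 == 0 by rewrite eq_le xs exprn_ge0.
by rewrite expf_eq0/= normr_eq0 => /eqP.
Qed.

Lemma jt_sup0 : jt_sup 0 = 0%E.
Proof.
apply/eqP; rewrite eq_le jt_sup_ge0 andbT; apply: jt_sup_le => m F sF _.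
rewrite lee_fin /jt_sum big1// => i _.
by rewrite fsbig1 ?normr0 ?expr0n.
Qed.

Lemma jt_sumD_le x y a b m (F : 'I_m -> set node) :
  0 < a -> 0 < b -> (forall i, finite_set (F i)) ->
  jt_sum (x + y) F <= (1 + b / a) * jt_sum x F + (1 + a / b) * jt_sum y F.
Proof.
move=> a0 b0 fF; rewrite /jt_sum 2!mulr_sumr -big_split/=.
apply: ler_sum => i _.
have -> : \sum_(s \in F i) (x + y) s =
    \sum_(s \in F i) x s + \sum_(s \in F i) y s by rewrite -fsbig_split.
set u := \sum_(s \in F i) x s; set v := \sum_(s \in F i) y s.
rewrite -!normrX !ger0_norm ?sqr_ge0// -subr_ge0.
have -> : (1 + b / a) * u ^+ 2 + (1 + a / b) * v ^+ 2 - (u + v) ^+ 2 =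
    (b * u - a * v) ^+ 2 / (a * b) by field; rewrite ?gt_eqF.
by rewrite divr_ge0 ?sqr_ge0// mulr_ge0 ?ltW.
Qed.

Lemma jt_sumZ a x m (F : 'I_m -> set node) :
  (forall i, finite_set (F i)) -> jt_sum (a *: x) F = a ^+ 2 * jt_sum x F.
Proof.
move=> fF; rewrite /jt_sum mulr_sumr; apply: eq_bigr => i _.
have -> : \sum_(s \in F i) (a *: x) s = a * \sum_(s \in F i) x s.
  by rewrite mulr_fsumr.
by rewrite normrM exprMn [`|a| ^+ 2]real_normK ?num_real.
Qed.

Lemma jt_sup_fin x : x \in jt_pred -> (fine (jt_sup x))%:E = jt_sup x.
Proof. by move/jt_predP => xoo; rewrite fineK// ge0_fin_numE// jt_sup_ge0. Qed.

Lemma jt_norm_ge0 x : 0 <= jt_norm x.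
Proof. exact: sqrtr_ge0. Qed.

Lemma jt_supE x : x \in jt_pred -> jt_sup x = (jt_norm x ^+ 2)%:E.
Proof.
move=> xJ; rewrite -(jt_sup_fin xJ) /jt_norm sqr_sqrtr//.
by rewrite -lee_fin jt_sup_fin// jt_sup_ge0.
Qed.

Lemma jt_sum_le_norm x m (F : 'I_m -> set node) : x \in jt_pred ->
  (forall i, tree_segment (F i)) -> trivIset setT F ->
  jt_sum x F <= jt_norm x ^+ 2.
Proof. by move=> xJ sF tF; rewrite -lee_fin -jt_supE// jt_sup_ge. Qed.

Lemma jt_norm_eq0 x : x \in jt_pred -> jt_norm x = 0 -> x = 0.
Proof. by move=> xJ x0; apply: jt_sup_eq0; rewrite jt_supE// x0 expr0n. Qed.

Lemma jt_supD_le x y : x \in jt_pred -> y \in jt_pred ->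
  (jt_sup (x + y)%R <= ((jt_norm x + jt_norm y) ^+ 2)%:E)%E.
Proof.
move=> xJ yJ.
have [x0|xN0] := eqVneq (jt_norm x) 0.
  by rewrite x0 (jt_norm_eq0 xJ x0) !add0r jt_supE.
have [y0|yN0] := eqVneq (jt_norm y) 0.
  by rewrite y0 (jt_norm_eq0 yJ y0) !addr0 jt_supE.
have x_gt0 : 0 < jt_norm x by rewrite lt_neqAle eq_sym xN0 jt_norm_ge0.
have y_gt0 : 0 < jt_norm y by rewrite lt_neqAle eq_sym yN0 jt_norm_ge0.
apply: jt_sup_le => m F sF tF; rewrite lee_fin.
apply: le_trans (jt_sumD_le x y x_gt0 y_gt0 (fun i => (sF i).2)) _.
have -> : (jt_norm x + jt_norm y) ^+ 2 =
    (1 + jt_norm y / jt_norm x) * jt_norm x ^+ 2 +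
    (1 + jt_norm x / jt_norm y) * jt_norm y ^+ 2.
  by field; rewrite xN0 yN0.
by rewrite lerD// ler_wpM2l ?jt_sum_le_norm// addr_ge0// divr_ge0// jt_norm_ge0.
Qed.

Lemma jt_supZ_le a x : x \in jt_pred ->
  (jt_sup (a *: x)%R <= ((`|a| * jt_norm x) ^+ 2)%:E)%E.
Proof.
move=> xJ; apply: jt_sup_le => m F sF tF.
rewrite jt_sumZ; last by move=> i; exact: (sF i).2.
by rewrite lee_fin exprMn real_normK ?num_real// ler_wpM2l ?sqr_ge0// jt_sum_le_norm.
Qed.

Lemma jt_submod_closed : submod_closed jt_pred.
Proof.
have JZ a x : x \in jt_pred -> a *: x \in jt_pred.
  by move=> xJ; apply/jt_predP; apply: le_lt_trans (jt_supZ_le a xJ) _; rewrite ltry.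
split=> [|a x y xJ yJ]; first by apply/jt_predP; rewrite jt_sup0 ltry.
apply/jt_predP; apply: le_lt_trans (jt_supD_le (JZ a _ xJ) yJ) _.
by rewrite ltry.
Qed.

HB.instance Definition _ :=
  GRing.isSubmodClosed.Build R (node -> R) jt_pred jt_submod_closed.

Record JT := { JTval :> node -> R ; _ : JTval \in jt_pred }.

HB.instance Definition _ := [isSub for JTval].
HB.instance Definition _ := [Choice of JT by <:].
HB.instance Definition _ := [SubChoice_isSubLmodule of JT by <:].

Definition JT_norm (x : JT) : R := jt_norm x.

Lemma sqr_le_norm (e : \bar R) (c : R) : 0 <= c -> (e <= (c ^+ 2)%:E)%E ->
  (0 <= e)%E -> Num.sqrt (fine e) <= c.
Proof.
case: e => [r||]//= c0; rewrite lee_fin => rc _.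
by rewrite -[leRHS]ger0_norm// -sqrtr_sqr ler_wsqrtr.
Qed.

Lemma JT_normD (x y : JT) : JT_norm (x + y) <= JT_norm x + JT_norm y.
Proof.
by apply: sqr_le_norm (jt_supD_le (valP x) (valP y)) _;
  rewrite ?jt_sup_ge0 ?addr_ge0 ?jt_norm_ge0.
Qed.

Lemma JT_normZ a (x : JT) : JT_norm (a *: x) = `|a| * JT_norm x.
Proof.
have leZ b (z : JT) : JT_norm (b *: z) <= `|b| * JT_norm z.
  apply: sqr_le_norm (jt_supZ_le b (valP z)) _;
    by rewrite ?jt_sup_ge0 ?mulr_ge0 ?jt_norm_ge0.
apply/eqP; rewrite eq_le leZ/=.
have [->|a0] := eqVneq a 0; first by rewrite normr0 mul0r jt_norm_ge0.
rewrite -ler_pdivlMl ?normr_gt0// -normfV.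
by rewrite -[in leLHS](scalerK a0 x).
Qed.

Lemma JT_norm_eq0 (x : JT) : JT_norm x = 0 -> x = 0.
Proof. by move=> x0; apply/val_inj; exact: jt_norm_eq0 (valP x) x0. Qed.

HB.instance Definition _ := @Lmodule_isNormed.Build R JT
  JT_norm JT_normD JT_normZ JT_norm_eq0.

End JamesTree.

Section ell1.
Variable R : realType.
Implicit Types (x y : nat -> R) (a : R).

Definition ell1_sum x : \bar R := (\sum_(0 <= n <oo) `|x n|%:E)%E.

Definition ell1_pred : {pred (nat -> R)} := mem [set x | (ell1_sum x < +oo)%E].

Lemma ell1_predP x : reflect (ell1_sum x < +oo)%E (x \in ell1_pred).
Proof. by apply: (iffP idP) => [/set_mem|/mem_set]. Qed.

Lemma ell1_sum_ge0 x : (0 <= ell1_sum x)%E.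
Proof. by apply: nneseries_ge0 => n _ _; rewrite lee_fin. Qed.

Lemma ell1_sumD_le x y : (ell1_sum (x + y)%R <= ell1_sum x + ell1_sum y)%E.
Proof.
rewrite /ell1_sum -nneseriesD => [|n _ _|n _ _]; rewrite ?lee_fin//.
apply: lee_nneseries => n _; first by rewrite lee_fin.
by rewrite -EFinD lee_fin; exact: ler_normD.
Qed.

Lemma ell1_sumZ a x : ell1_sum (a *: x) = (`|a|%:E * ell1_sum x)%E.
Proof.
rewrite /ell1_sum -nneseriesZl => [|n _]; last by rewrite lee_fin.
by apply: eq_eseriesr => n _; rewrite -EFinM -normrM.
Qed.

Lemma ell1_sum_eq0 x : ell1_sum x = 0%E -> x = 0.
Proof.
move=> x0; apply/funext => n; apply/eqP; rewrite -normr_eq0 eq_le normr_ge0 andbT.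
have -> : `|x n| <= 0 = (`|x n|%:E <= ell1_sum x)%E by rewrite x0.
rewrite /ell1_sum (@nneseriesD1 _ _ n)// leeDl//.
by apply: nneseries_ge0 => m _ _; rewrite lee_fin.
Qed.

Lemma ell1_submod_closed : submod_closed ell1_pred.
Proof.
split=> [|a x y /ell1_predP xl /ell1_predP yl].
  apply/ell1_predP; rewrite /ell1_sum eseries0 ?ltry// => n _ _.
  by rewrite normr0.
apply/ell1_predP; apply: le_lt_trans (ell1_sumD_le _ _) _.
rewrite ell1_sumZ lte_add_pinfty//.
by rewrite lte_mul_pinfty// ?lee_fin.
Qed.

HB.instance Definition _ :=
  GRing.isSubmodClosed.Build R (nat -> R) ell1_pred ell1_submod_closed.

Record ell1 := { ell1val :> nat -> R ; _ : ell1val \in ell1_pred }.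

HB.instance Definition _ := [isSub for ell1val].
HB.instance Definition _ := [Choice of ell1 by <:].
HB.instance Definition _ := [SubChoice_isSubLmodule of ell1 by <:].

Definition ell1_norm (x : ell1) : R := fine (ell1_sum x).

Lemma ell1_sumE (x : ell1) : ell1_sum x = (ell1_norm x)%:E.
Proof.
have /ell1_predP xl := valP x.
by rewrite fineK// ge0_fin_numE// ell1_sum_ge0.
Qed.

Lemma ell1_normD (x y : ell1) : ell1_norm (x + y) <= ell1_norm x + ell1_norm y.
Proof. by rewrite -lee_fin EFinD -!ell1_sumE; exact: ell1_sumD_le. Qed.

Lemma ell1_normZ a (x : ell1) : ell1_norm (a *: x) = `|a| * ell1_norm x.
Proof. by apply: EFin_inj; rewrite EFinM -!ell1_sumE; exact: ell1_sumZ. Qed.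

Lemma ell1_norm_eq0 (x : ell1) : ell1_norm x = 0 -> x = 0.
Proof.
by move=> x0; apply/val_inj; apply: ell1_sum_eq0; rewrite ell1_sumE x0.
Qed.

HB.instance Definition _ := @Lmodule_isNormed.Build R ell1
  ell1_norm ell1_normD ell1_normZ ell1_norm_eq0.

End ell1.

(* In [{within range f, continuous g}] the set [range f] carries the subspace
   topology; the values of [g] outside [range f] are irrelevant. *)
Definition homeomorphism_onto_image (X Y : topologicalType) (f : X -> Y) :=
  continuous f /\
  exists2 g : Y -> X, cancel f g & {within range f, continuous g}.

(* Main.v *)
Require Import Defs.
From HB Require Import structures.
From mathcomp Require Import all_boot all_order all_algebra.
From mathcomp Require Import ring lra zify.
From mathcomp Require Import all_classical reals ereal topology normedtype.
From mathcomp Require Import sequences.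
Import Order.TTheory GRing.Theory Num.Theory.
Import numFieldNormedType.Exports.
Local Open Scope classical_set_scope.
Local Open Scope ring_scope.

Set Implicit Arguments.
Unset Strict Implicit.
Unset Printing Implicit Defensive.

(* If T embeds ell^1, linear algebra and a truncation turn suitable normalized
   combinations of the unit vectors into a bounded block sequence w_n, supported
   on the levels [p n, p n.+1), with c sum |b_n| <= |sum b_n w_n|.

   Fix e > 0. Only boundedly many nodes u of level p n are "heavy", i.e. carry
   above u a segment on which w_n sums to at least e. Enumerate them as t n j,
   and apply Ramsey's theorem to the pairs (n, n'), coloured by which t n j lie
   below which t n' j' and by the sums of w_n from t n j to t n' j, up to e.
   Along a homogeneous subsequence, let a segment F meet its first heavy node
   at stage a and its last one at stage b: F must follow a single branch
   t n j between them, where its sums with the w_n are e-constant, while outside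
   [a, b] they are at most e, except where F starts. Hence averages y of
   differences of consecutive w_n have arbitrarily small sums on all segments.

   For x supported on levels below q and y with sums at most d on segments,
   |x + y|^2 <= |x|^2 + |y|^2 + O_q(d |x|), because all but O_q(1) disjoint
   segments miss x. Adding up m such y successively gives ell^1-mass m but a norm
   O(sqrt m), which contradicts the lower bound. *)

(** * Unbounded sets of naturals and Ramsey's theorem for pairs *)

Definition unbounded (A : set nat) := forall n, exists2 m, (n <= m)%N & A m.

Lemma unbounded_pigeonhole (K : finType) (c : nat -> K) (A : set nat) :
  unbounded A -> exists k, unbounded [set m | A m /\ c m = k].
Proof.
move=> infA; apply: contrapT => /forallNP noK.
have {noK} /choice[N hN] k : exists n, forall m, (n <= m)%N -> A m -> c m <> k.
  apply: contrapT => /forallNP h; apply: (noK k) => n; apply: contrapT => h'.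
  by apply: (h n) => m nm Am cm; apply: h'; exists m.
have [m + Am] := infA (\max_k N k)%N.
by move=> /(leq_trans (leq_bigmax (c m))) /hN /(_ Am); apply.
Qed.

Lemma increasing_lt (f : nat -> nat) (i j : nat) :
  (forall i, f i < f i.+1)%N -> (i < j)%N -> (f i < f j)%N.
Proof.
move=> fS; elim: j => // j IH; rewrite ltnS leq_eqVlt => /predU1P[->//|/IH].
by move=> /ltn_trans; apply.
Qed.

Lemma increasing_le (f : nat -> nat) (i j : nat) :
  (forall i, f i < f i.+1)%N -> (i <= j)%N -> (f i <= f j)%N.
Proof.
by move=> fS; rewrite leq_eqVlt => /predU1P[->//|/(increasing_lt fS)/ltnW].
Qed.

Lemma increasing_ge_id (f : nat -> nat) (i : nat) :
  (forall i, f i < f i.+1)%N -> (i <= f i)%N.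
Proof. by move=> fS; elim: i => // i /leq_ltn_trans; apply. Qed.

Lemma unbounded_enum (A : set nat) : unbounded A ->
  exists f : nat -> nat, (forall i, f i < f i.+1)%N /\ forall i, A (f i).
Proof.
move=> infA.
have /choice[g hg] n : exists m, (n < m)%N /\ A m.
  by have [m nm Am] := infA n.+1; exists m.
exists (fun i => iter i g (g 0%N)); split=> i.
  by rewrite iterS; have [] := hg (iter i g (g 0%N)).
by case: i => [|i]; rewrite ?iterS /=; apply: (hg _).2.
Qed.

Lemma infinite_ramsey (K : finType) (c : nat -> nat -> K) :
  exists f : nat -> nat, (forall i, f i < f i.+1)%N /\
    exists k, forall i j, (i < j)%N -> c (f i) (f j) = k.
Proof.
(* A state [(a, k, A)] records a chosen point [a] and an unbounded set [A] beyond it, every member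
   of which forms with [a] a pair of colour [k]. Later points are chosen inside [A]. *)
pose ok (t : nat * K * set nat) := unbounded t.2 /\
  forall m, t.2 m -> (t.1.1 < m)%N /\ c t.1.1 m = t.1.2.
have next (A : set nat) : unbounded A ->
    exists t, [/\ ok t, A t.1.1 & t.2 `<=` A].
  move=> infA; have [a _ Aa] := infA 0%N.
  have infA' : unbounded [set m | A m /\ (a < m)%N].
    move=> n; have [m nm Am] := infA (maxn n a.+1).
    exists m; first by rewrite (leq_trans _ nm)// leq_maxl.
    by split=> //; rewrite (leq_trans _ nm)// leq_maxr.
  have [k infk] := unbounded_pigeonhole (c a) infA'.
  exists (a, k, [set m | (A m /\ (a < m)%N) /\ c a m = k]).
  by split=> //= [|m [[]]//]; split=> // m [[]].
have [|t0 [ok0 _ _]] := next setT; first by move=> n; exists n.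
have /choice[g hg] t : exists t', ok t ->
    [/\ ok t', t.2 t'.1.1 & t'.2 `<=` t.2].
  have [okt|nok] := pselect (ok t); last by exists t.
  by have [t' ?] := next _ okt.1; exists t'.
pose s i := iter i g t0.
have oks i : ok (s i) by elim: i => // i /hg[].
have sS i j : (i < j)%N -> (s j).2 `<=` (s i).2 /\ (s i).2 (s j).1.1.
  elim: j => // j IH; have [_ sj ssj] := hg _ (oks j).
  rewrite ltnS leq_eqVlt => /predU1P[->|/IH[h1 h2]]; first by split.
  by split; [apply: subset_trans ssj h1|apply: h1].
(* Each chosen point has one colour with all later ones, and some colour recurs at unboundedly many
   indices. *)
have [|k infk] := unbounded_pigeonhole (fun i => (s i).1.2) (A := setT).
  by move=> n; exists n.
have [f [fS fk]] := unbounded_enum infk.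
exists (fun i => (s (f i)).1.1); split=> [i|].
  by have [_ /((oks (f i)).2 _)[]] := sS _ _ (fS i).
exists k => i j ij.
have [_ /((oks (f i)).2 _)[_ ->]] := sS _ _ (increasing_lt fS ij).
by case: (fk i).
Qed.

(** * The prefix order and segments of the tree *)

Lemma prefix_comparable (s t u : node) :
  prefix s u -> prefix t u -> (size s <= size t)%N -> prefix s t.
Proof.
rewrite !prefixE => /eqP su /eqP tu st; apply/eqP.
by rewrite -[in LHS]tu take_takel.
Qed.

Lemma chain_prefix (F : set node) (s t : node) : tree_interval F ->
  F s -> F t -> (size s <= size t)%N -> prefix s t.
Proof.
move=> [chF _] Fs Ft st; case: (chF _ _ Fs Ft) => // ts.
by have := prefix_comparable (prefix_refl s) ts st.
Qed.

Lemma segment_level (F : set node) (p : nat) (s t : node) : tree_interval F ->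
  F s -> F t -> (size s <= p <= size t)%N -> exists2 u, F u & size u = p.
Proof.
move=> sF Fs Ft /andP[sp pt]; exists (take p t); last by rewrite size_takel.
have st := chain_prefix sF Fs Ft (leq_trans sp pt).
apply: (sF.2 s _ t) => //; last exact: prefix_take.
by apply: prefix_comparable st (prefix_take _ _) _; rewrite size_takel.
Qed.

Lemma segment_restrict (F : set node) (a : nat) : tree_segment F ->
  tree_segment (F `&` [set s | (a <= size s)%N]).
Proof.
move=> [[chF cvF] fF]; split; last exact: finite_setIl.
split=> [s t [Fs _] [Ft _]|s w t [Fs /= sa] [Ft _] sw wt]; first exact: chF.
by split; [exact: (cvF s w t)|rewrite /= (leq_trans sa)// size_prefix].
Qed.

Definition tree_between (s t : node) : set node :=
  [set u | prefix s u /\ prefix u t].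

Lemma between_segment (s t : node) : tree_segment (tree_between s t).
Proof.
split; first split=> [u v [_ ut] [_ vt]|u w v [su _] [_ vt] uw wv].
- have [uv|/ltnW vu] := leqP (size u) (size v).
    by left; exact: (prefix_comparable ut vt).
  by right; exact: (prefix_comparable vt ut).
- by split; [exact: prefix_trans su uw|exact: prefix_trans wv vt].
apply/finite_seqP.
exists [seq u <- [seq take i t | i <- iota 0 (size t).+1] | prefix s u].
rewrite eqEsubset; split=> u.
  case=> su ut; have uE : take (size u) t = u by apply/eqP; rewrite -prefixE.
  rewrite /mkset mem_filter su andTb; apply/mapP; exists (size u) => //.
  by rewrite mem_iota add0n ltnS size_prefix.
rewrite /mkset mem_filter => /andP[su /mapP[i _ ui]]; split=> //.
by rewrite ui prefix_take.
Qed.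

(** * Sums over segments and their relation to the norm *)

Section SegmentSums.
Variable R : realType.
Implicit Types (x y : node -> R) (F G : set node).

Definition segsum F x : R := \sum_(s \in F) x s.

Lemma eq_segsum F G x : (forall s, x s <> 0 -> (F s <-> G s)) ->
  segsum F x = segsum G x.
Proof.
move=> FG; rewrite /segsum fsbig_mkcond [RHS]fsbig_mkcond.
apply: eq_fsbigr => s _; rewrite /patch.
have [xs0|/eqP/FG fg] := eqVneq (x s) 0; first by rewrite xs0 !if_same.
suff -> : (s \in F) = (s \in G) by [].
by apply/idP/idP => /set_mem h; apply/mem_set; apply/fg.
Qed.

Lemma segsum_neq0 F x : segsum F x <> 0 -> exists2 s, F s & x s <> 0.
Proof.
move=> Fx; apply: contrapT => no; apply: Fx; apply: fsbig1 => s Fs.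
by apply: contrapT => xs; apply: no; exists s.
Qed.

Lemma segsumD F x y : finite_set F ->
  segsum F (x + y) = segsum F x + segsum F y.
Proof. by move=> fF; rewrite /segsum -fsbig_split. Qed.

Lemma segsumZ F a x : segsum F (a *: x) = a * segsum F x.
Proof. by rewrite /segsum mulr_fsumr. Qed.

Lemma segsumB F x y : finite_set F ->
  segsum F (x - y) = segsum F x - segsum F y.
Proof. by move=> fF; rewrite segsumD// -scaleN1r segsumZ mulN1r. Qed.

Lemma jt_sumE x m (F : 'I_m -> set node) :
  jt_sum x F = \sum_(i < m) segsum (F i) x ^+ 2.
Proof. by apply: eq_bigr => i _; rewrite real_normK ?num_real. Qed.

Lemma JT_normE (x : JT R) : `|x| = jt_norm x.
Proof. by []. Qed.

Lemma JT_norm_le (x : JT R) (c : R) : 0 <= c ->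
  (forall m (F : 'I_m -> set node), (forall i, tree_segment (F i)) ->
    trivIset setT F -> jt_sum x F <= c ^+ 2) -> `|x| <= c.
Proof.
move=> c0 h; apply: sqr_le_norm c0 _ (jt_sup_ge0 _).
by apply: jt_sup_le => m F sF tF; rewrite lee_fin h.
Qed.

Lemma JT_sum_le (x : JT R) m (F : 'I_m -> set node) :
  (forall i, tree_segment (F i)) -> trivIset setT F ->
  jt_sum x F <= `|x| ^+ 2.
Proof. exact: jt_sum_le_norm (valP x). Qed.

Lemma segsum_le_norm (x : JT R) F : tree_segment F -> `|segsum F x| <= `|x|.
Proof.
move=> sF; rewrite -(@ler_pXn2r _ 2)// ?nnegrE//.
have := @JT_sum_le x 1 (fun=> F) (fun=> sF).
by rewrite /jt_sum big_ord1; apply; move=> i j _ _ _; rewrite !ord1.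
Qed.

Lemma JT_addE (x y : JT R) : (x + y : JT R) = (x : node -> R) + y :> (node -> R).
Proof. by []. Qed.

Lemma JT_subE (x y : JT R) : (x - y : JT R) = (x : node -> R) - y :> (node -> R).
Proof. by []. Qed.

Lemma JT_scaleE a (x : JT R) : (a *: x : JT R) = a *: (x : node -> R) :> (node -> R).
Proof. by []. Qed.

End SegmentSums.

(** * Norm estimates, counting of heavy nodes, truncation at a level *)

Lemma finite_size_bound (F : set node) : finite_set F ->
  exists n, forall s, F s -> (size s < n)%N.
Proof.
move=> /finite_seqP[r ->]; exists (\max_(s <- r) size s).+1 => s sr.
by rewrite ltnS; apply: leq_bigmax_seq.
Qed.

Lemma prefix_size_eq (s t : node) : prefix s t -> size s = size t -> s = t.
Proof. by rewrite prefixE => /eqP st sz; rewrite -st sz take_size. Qed.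

Lemma segment_truncate (F : set node) (q : nat) : tree_segment F ->
  tree_segment (F `&` [set s | (size s < q)%N]).
Proof.
move=> [[chF cvF] fF]; split; last exact: finite_setIl.
split=> [s t [Fs _] [Ft _]|s w t [Fs _] [Ft /= tq] sw wt]; first exact: chF.
by split; [exact: (cvF s w t)|rewrite /= (leq_ltn_trans _ tq)// size_prefix].
Qed.

Section Estimates.
Variable R : realType.

(** Expanding the squares, a cross term, of size at most [2 * |x| * d], arises only for those [F i]
    that contain a node of length below [q]. Choosing such a node in each is injective because the
    segments are disjoint, so the nodes of length at most [q] bound their number. *)
Lemma norm_add_sqr (x y : JT R) (q : nat) (d : R) : 0 <= d ->
  (forall s, x s <> 0 -> (size s < q)%N) ->
  (forall F, tree_segment F -> `|segsum F y| <= d) ->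
  `|x + y| ^+ 2 <=
    `|x| ^+ 2 + `|y| ^+ 2 + #|{bseq q of bool}|%:R * (2 * `|x| * d).
Proof.
move=> d0 xq yd; set K := (X in _ <= X).
have xd0 : 0 <= 2 * `|x| * d by rewrite mulr_ge0// mulr_ge0.
have K0 : 0 <= K by rewrite addr_ge0 ?addr_ge0 ?exprn_ge0// mulr_ge0.
suff : `|x + y| <= Num.sqrt K.
  by move=> h; rewrite -[leRHS]sqr_sqrtr// lerXn2r// nnegrE ?sqrtr_ge0.
apply: JT_norm_le => [|m F sF tF]; first exact: sqrtr_ge0.
rewrite sqr_sqrtr// jt_sumE JT_addE.
pose meets i := `[< exists2 s, F i s & (size s < q)%N >].
have h1 i : segsum (F i) ((x : node -> R) + y) ^+ 2 <=
    segsum (F i) x ^+ 2 + segsum (F i) y ^+ 2 +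
    (if meets i then 2 * `|x| * d else 0).
  rewrite segsumD; last exact: (sF i).2.
  set a := segsum (F i) x; set b := segsum (F i) y.
  rewrite /meets; case: asboolP => [_|nm]; last first.
    have -> : a = 0.
      apply: contrapT => /segsum_neq0[s Fs xs]; apply: nm; exists s => //.
      exact: xq.
    by rewrite add0r expr0n/= add0r addr0.
  rewrite sqrrD addrAC lerD2l -mulrA -mulr_natl ler_pM2l//.
  rewrite (le_trans (ler_norm _))// normrM ler_pM//.
    exact: segsum_le_norm.
  exact: yd.
apply: le_trans (ler_sum _ (fun i _ => h1 i)) _.
rewrite !big_split/= -!jt_sumE; apply: lerD; first by rewrite lerD// JT_sum_le.
rewrite -big_mkcond (sumr_const meets) -[leLHS]mulr_natl ler_wpM2r// ler_nat.
have /choice[h hP] i : exists s : {bseq q of bool}, meets i -> F i s.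
  case: (asboolP (exists2 s, F i s & (size s < q)%N)) => [[s Fs sq]|nm].
    by exists (Bseq (ltnW sq)).
  by exists [bseq] => /asboolP.
rewrite -(@card_in_imset _ _ h); first exact: max_card.
move=> i j; rewrite !unfold_in => /hP hi /hP hj hij.
by apply: (tF i j) => //; exists (h i); split=> //; rewrite hij.
Qed.

(** Segments above distinct nodes of one level are disjoint, so together they form an admissible
    family for the norm of [x]. *)
Lemma card_heavy_nodes (x : JT R) (p : nat) (e : R) (B : {set p.-tuple bool}) :
  0 <= e ->
  (forall t, t \in B -> exists G, [/\ tree_segment G,
     forall s, G s -> prefix t s & e <= `|segsum G x|]) ->
  #|B|%:R * e ^+ 2 <= `|x| ^+ 2.
Proof.
move=> e0 hB.
have /choice[G hG] (i : 'I_#|B|) := hB _ (enum_valP i).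
have tG : trivIset setT G.
  move=> i j _ _ [s [/(let: And3 _ h _ := hG i in h s) si]].
  move=> /(let: And3 _ h _ := hG j in h s) sj.
  apply/enum_val_inj/val_inj/prefix_size_eq; last by rewrite !size_tuple.
  by apply: prefix_comparable si sj _; rewrite !size_tuple.
have sG i : tree_segment (G i) by case: (hG i).
apply: le_trans (JT_sum_le x sG tG).
rewrite mulr_natl -[X in _ *+ X]card_ord -sumr_const; apply: ler_sum => i _.
by rewrite ler_pXn2r ?nnegrE//; case: (hG i).
Qed.

Definition trunc (q : nat) (x : node -> R) : node -> R :=
  fun s => if (size s < q)%N then x s else 0.

(** Cutting every segment of a family at level [q] leaves disjoint segments, so each sum for the
    truncation is already a sum for [x]. *)
Lemma trunc_pred (q : nat) (x : node -> R) :
  x \in jt_pred (R:=R) -> trunc q x \in jt_pred (R:=R).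
Proof.
move=> /jt_predP xJ; apply/jt_predP; apply: le_lt_trans xJ.
apply: jt_sup_le => m F sF tF.
pose G i := F i `&` [set s | (size s < q)%N].
suff -> : jt_sum (trunc q x) F = jt_sum x G.
  apply: jt_sup_ge => [i|i j _ _ [s [[Fs _] [Fs' _]]]].
    exact: segment_truncate.
  by apply: (tF i j) => //; exists s.
rewrite !jt_sumE; apply: eq_bigr => i _; congr (_ ^+ 2).
rewrite /segsum fsbig_mkcond [RHS]fsbig_mkcond; apply: eq_fsbigr => s _.
rewrite /patch in_setI /trunc.
have -> : (s \in [set s | (size s < q)%N]) = (size s < q)%N.
  by apply/idP/idP => [/set_mem//|h]; apply/mem_set.
by case: (s \in F i); case: (size s < q)%N.
Qed.

Definition JT_trunc (q : nat) (x : JT R) : JT R :=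
  Build_JT (trunc_pred q (valP x)).

Lemma JT_trunc_approx (z : JT R) (e : R) (p : nat) : 0 < e ->
  exists2 q, (p <= q)%N & `|z - JT_trunc q z| <= e.
Proof.
move=> e0; have e2 : 0 < e ^+ 2 by rewrite exprn_gt0.
(* A family F that almost attains the norm of z leaves at most e^2 for any
   disjoint family, in particular for one beyond the levels met by F. *)
have supz := jt_supE (valP z).
have [|_ [m [F [sF tF ->]]]] := @ub_ereal_sup_adherent R
    [set e | exists (m : nat) (F : 'I_m -> set node),
      [/\ forall i, tree_segment (F i), trivIset setT F &
          e = (jt_sum z F)%:E]] _ e2.
  by rewrite -/(jt_sup _) supz.
rewrite -/(jt_sup _) supz -EFinB lte_fin => zF.
have /choice[n hn] i := finite_size_bound (sF i).2.
exists (maxn p (\max_i n i)); first exact: leq_maxl.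
set q := maxn _ _.
have hq i s : F i s -> (size s < q)%N.
  move=> /hn /leq_trans; apply; rewrite leq_max; apply/orP; right.
  exact: leq_bigmax.
apply: JT_norm_le => [|k G sG tG]; first exact: ltW.
pose H i := G i `&` [set s | (q <= size s)%N].
have -> : jt_sum (z - JT_trunc q z) G = jt_sum z H.
  rewrite !jt_sumE; apply: eq_bigr => i _; congr (_ ^+ 2).
  rewrite /segsum fsbig_mkcond [RHS]fsbig_mkcond; apply: eq_fsbigr => s _.
  rewrite /patch in_setI JT_subE.
  have -> : (s \in [set s | (q <= size s)%N]) = (q <= size s)%N.
    by apply/idP/idP => [/set_mem//|h]; apply/mem_set.
  have -> : ((z : node -> R) - JT_trunc q z) s = z s - trunc q z s by [].
  rewrite /trunc ltnNge.
  by case: (s \in G i); case: (q <= size s)%N; rewrite /= ?subrr ?subr0.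
pose FH (i : 'I_(m + k)) :=
  match fintype.split i with inl a => F a | inr b => H b end.
have sFH i : tree_segment (FH i).
  by rewrite /FH; case: fintype.split => // b; exact: segment_restrict.
have tFH : trivIset setT FH.
  move=> i j _ _ [s []]; rewrite /FH => si sj.
  rewrite -(splitK i) -(splitK j).
  case: (fintype.split i) si => a; case: (fintype.split j) sj => b.
  - by move=> Fb Fa; congr (unsplit (inl _)); apply: (tF a b) => //; exists s.
  - by move=> [_ /= qs] /hq; rewrite ltnNge qs.
  - by move=> /hq + [_ /= qs]; rewrite ltnNge qs.
  - by move=> [Hb _] [Ha _]; congr (unsplit (inr _)); apply: (tG a b) => //; exists s.
have := JT_sum_le z sFH tFH; rewrite /jt_sum big_split_ord/=.
under eq_bigr do rewrite /FH (unsplitK (inl _)).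
under [X in _ + X <= _]eq_bigr do rewrite /FH (unsplitK (inr _)).
rewrite -/(jt_sum z F) -/(jt_sum z H).
move: zF; rewrite JT_normE; lra.
Qed.

End Estimates.

(** * Block sequences: heavy nodes and a homogeneous subsequence *)

Section BlockSequence.
Variables (R : realType) (p : nat -> nat) (w : nat -> JT R) (C : R).
Hypothesis pS : forall n, (p n < p n.+1)%N.
Hypothesis wp : forall n s, w n s <> 0 -> (p n <= size s < p n.+1)%N.
Hypothesis wC : forall n, `|w n| <= C.

Definition heavy (e : R) (n : nat) (u : node) := exists G,
  [/\ tree_segment G, forall s, G s -> prefix u s & e <= `|segsum G (w n)|].

Let C0 : 0 <= C.
Proof. exact: le_trans (wC 0). Qed.

Lemma heavy_enum (e : R) : 0 < e -> exists M, forall n, exists t : 'I_M -> node,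
  (forall j, size (t j) = p n) /\
  forall u, size u = p n -> heavy e n u -> exists j, t j = u.
Proof.
move=> e0; exists (Num.truncn (C ^+ 2 / e ^+ 2)).+1 => n.
set M := _.+1; pose B := [set u : (p n).-tuple bool | `[< heavy e n u >]]%SET.
have cB : (#|B| < M)%N.
  rewrite -(ltr_nat R) (le_lt_trans _ (truncnS_gt _))//.
  rewrite ler_pdivlMr ?exprn_gt0//.
  apply: le_trans (card_heavy_nodes (x := w n) (ltW e0) _) _ => [u|].
    by rewrite inE => /asboolP.
  by rewrite lerXn2r// nnegrE.
(* The all-[false] node pads the list, so that one index set ['I_M] serves every level; only
   finitely many colours are then possible. *)
pose t (j : 'I_M) := nth (nseq_tuple (p n) false) (enum B) j : node.
exists t; split=> [j|u su hu]; first by rewrite /t size_tuple.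
have uB : Tuple (introT eqP su) \in enum B.
  by rewrite mem_enum inE; apply/asboolP.
have iM : (index (Tuple (introT eqP su)) (enum B) < M)%N.
  by rewrite (ltn_trans _ cB)// cardE index_mem.
by exists (Ordinal iM); rewrite /t /= nth_index.
Qed.

(** If [F] crosses level [p n], its part from there on witnesses that the crossing node is heavy.
    Otherwise [F] meets the support of [w n] without reaching down to level [p n], so it starts
    inside block [n], which a given [F] does for only one [n]. *)
Lemma heavy_or_start (e : R) (n : nat) (F : set node) : 0 < e ->
  tree_segment F -> e <= `|segsum F (w n)| ->
  (exists u, [/\ F u, size u = p n & heavy e n u]) \/
  ((exists2 s, F s & (size s < p n.+1)%N) /\
   forall s, F s -> (p n <= size s)%N).
Proof.
move=> e0 sF eF.
have [[u [Fu su]]|nolevel] := pselect (exists u, F u /\ size u = p n).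
  left; exists u; split=> //; exists (F `&` [set s | (p n <= size s)%N]); split.
  - exact: segment_restrict.
  - by move=> s [Fs /= ps]; apply: chain_prefix sF.1 Fu Fs _; rewrite su.
  - rewrite (_ : segsum _ _ = segsum F (w n))//.
    by apply: eq_segsum => s /wp/andP[ps _]; split=> [[]|].
have [|s Fs /wp/andP[ps sp]] := @segsum_neq0 _ F (w n).
  by move=> F0; move: eF; rewrite F0 normr0 leNgt e0.
right; split=> [|s' Fs']; first by exists s.
rewrite leqNgt; apply/negP => /ltnW s'p; apply: nolevel.
have [|u Fu su] := segment_level (p := p n) sF.1 Fs' Fs; first by rewrite s'p.
by exists u.
Qed.

Lemma truncn_close (a b : R) : 0 <= a -> 0 <= b ->
  Num.truncn a = Num.truncn b -> `|a - b| <= 1.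
Proof.
move=> a0 b0 ab; have := truncn_itv a0; have := truncn_itv b0.
rewrite ab -natr1 => /andP[h1 h2] /andP[h3 h4].
rewrite ler_norml; apply/andP; split; lra.
Qed.

(** The set [E] depends on [F] but its size does not, so the exceptional pairs become negligible in
    long averages. Away from the common branch the bound [2 * e] comes from two sums below [e]; on
    the branch equality of colours even gives [e]. *)
Lemma alternating_subsequence (e : R) : 0 < e ->
  exists f : nat -> nat, (forall i, f i < f i.+1)%N /\
  forall F, tree_segment F -> exists E : seq nat, size E = 4%N /\
    forall i, i \notin E ->
      `|segsum F (w (f i.*2)) - segsum F (w (f i.*2.+1))| <= 2 * e.
Proof.
move=> e0; have [M /choice[t ht]] := heavy_enum e0.
(* Adding [C] makes the sum nonnegative and dividing by [e] makes [e] the unit, so equal integer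
   parts mean sums within [e] of each other. *)
pose v n m j := (segsum (tree_between (t n j) (t m j)) (w n) + C) / e.
pose B := (Num.truncn (2 * C / e)).
have vC n m j : 0 <= v n m j <= 2 * C / e.
  have := segsum_le_norm (w n) (between_segment (t n j) (t m j)).
  move=> /le_trans /(_ (wC n)); rewrite ler_norml => /andP[h1 h2].
  rewrite /v divr_ge0 ?ler_pM2r ?invr_gt0//=; lra.
pose c n m : {set 'I_M * 'I_M} * {ffun 'I_M -> 'I_B.+1} :=
  ([set jj | prefix (t n jj.1) (t m jj.2)]%SET,
   [ffun j => inord (Num.truncn (v n m j))]).
have [f [fS [k0 hk]]] := infinite_ramsey c.
exists f; split=> // F sF.
have pf i j : (i < j)%N -> (p (f i).+1 <= p (f j))%N.
  by move=> ij; apply: increasing_le => //; apply: increasing_lt.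
have colP i j i' j' a b : (i < j)%N -> (i' < j')%N ->
    prefix (t (f i) a) (t (f j) b) -> prefix (t (f i') a) (t (f j') b).
  move=> ij ij' h; have : (a, b) \in (c (f i') (f j')).1.
    by rewrite hk// -(hk _ _ ij) inE.
  by rewrite inE.
have colV i j i' j' a : (i < j)%N -> (i' < j')%N ->
    `|segsum (tree_between (t (f i) a) (t (f j) a)) (w (f i)) -
      segsum (tree_between (t (f i') a) (t (f j') a)) (w (f i'))| <= e.
  move=> ij ij'.
  have : val ((c (f i) (f j)).2 a) = val ((c (f i') (f j')).2 a) by rewrite !hk.
  have vB n m : (Num.truncn (v n m a) < B.+1)%N.
    by rewrite ltnS le_truncn//; case/andP: (vC n m a).
  rewrite /= !ffunE !inordK// => /truncn_close.
  have [v0 _] := andP (vC (f i) (f j) a).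
  have [v0' _] := andP (vC (f i') (f j') a).
  move=> /(_ v0 v0'); rewrite /v -mulrBl opprD addrACA subrr addr0.
  by rewrite normrM normfV (gtr0_norm e0) ler_pdivrMr// mul1r.
pose start i := (exists2 s, F s & (size s < p (f i).+1)%N) /\
   forall s, F s -> (p (f i) <= size s)%N.
have start_uniq i j : start i -> start j -> i = j.
  have wlog_lt i' j' : start i' -> start j' -> ~~ (i' < j')%N.
    move=> [[s Fs si] _] [_ /(_ _ Fs) sj]; apply/negP => /pf /leq_trans /(_ sj).
    by rewrite leqNgt si.
  move=> si sj; apply/eqP; rewrite eqn_leq leqNgt wlog_lt//=.
  by rewrite leqNgt wlog_lt.
(* At most one stage has [F] starting inside its block; the value [0] is a dummy when there is
   none. *)
have [e1 he1] : exists e1, forall i, start i -> i = e1.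
  have [[i si]|no] := pselect (exists i, start i).
    by exists i => j sj; exact: start_uniq.
  by exists 0%N => i si; case: no; exists i.
pose P i := `[< exists u, [/\ F u, size u = p (f i) & heavy e (f i) u] >].
have good i : ~~ P i -> i != e1 -> `|segsum F (w (f i))| < e.
  move=> /asboolPn nPi ie; rewrite ltNge; apply/negP => /(heavy_or_start e0 sF).
  by case=> // /he1 ie1; rewrite ie1 eqxx in ie.
have pair_good i : ~~ P i.*2 -> ~~ P i.*2.+1 -> i != e1./2 ->
    `|segsum F (w (f i.*2)) - segsum F (w (f i.*2.+1))| <= 2 * e.
  move=> P1 P2 ie.
  have h1 : i.*2 != e1 by lia.
  have h2 : i.*2.+1 != e1 by lia.
  rewrite (le_trans (ler_normB _ _))//.
  have := good _ P1 h1; have := good _ P2 h2; lra.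
have [[i0 Pi0]|noP] := pselect (exists i, P i); last first.
  exists (nseq 4 e1./2); split=> [|i]; first by rewrite size_nseq.
  rewrite mem_nseq /= => ie.
  by apply: pair_good => //; apply/negP => Pi; apply: noP; eexists; exact: Pi.
have exP : exists i, P i by exists i0.
(* A heavy node of [F] at stage [i] has length [p (f i)], which is at least [i]; as [F] is finite, a
   last heavy stage exists. *)
have [N hN] := finite_size_bound sF.2.
have ubP i : P i -> (i <= N)%N.
  move=> /asboolP[u [/hN uN su _]]; rewrite (leq_trans _ (ltnW uN))// su.
  by rewrite (leq_trans (increasing_ge_id i fS))// increasing_ge_id.
case: (ex_minnP exP) => a /asboolP[ua [Fa sa ha]] amin.
case: (ex_maxnP exP ubP) => b /asboolP[ub [Fb sb hb]] bmax.
(* The exceptional pairs: those containing the stage e1 at which F starts, the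
   first heavy stage a, and the last two stages of the common branch. *)
exists [:: e1./2; a./2; b./2; b./2.-1]; split=> // i.
rewrite !inE !negb_or => /and4P[ie ia ib ib'].
have [lt_ia|le_ai] := ltnP i.*2.+1 a.
  by apply: pair_good => //; apply/negP => /amin; lia.
have [lt_bi|le_ib] := ltnP b i.*2.
  by apply: pair_good => //; apply/negP => /bmax; lia.
have {}le_ai : (a <= i.*2)%N by lia.
have {}le_ib : (i.*2.+2 < b)%N by lia.
have [ja tja] := (ht (f a)).2 _ sa ha; have [jb tjb] := (ht (f b)).2 _ sb hb.
have ab : (a < b)%N by lia.
have uab : prefix ua ub.
  apply: chain_prefix sF.1 Fa Fb _; rewrite sa sb.
  by apply: increasing_le => //; apply: increasing_le => //; exact: ltnW.
have szt n j : size (t n j) = p n by case: (ht n).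
(* The colour of (a, b) puts t (f k) ja below ub for every k < b. *)
have tb k : (k < b)%N -> prefix (t (f k) ja) ub.
  move=> kb; rewrite -tjb; apply: colP ab kb _.
  by rewrite tja tjb.
have at_ k : (a <= k)%N -> (k < b)%N -> prefix ua (t (f k) ja).
  move=> ak kb; apply: prefix_comparable uab (tb _ kb) _.
  by rewrite szt sa; do 2 apply: increasing_le => //.
(* The support of [w (f k)] lies between the levels of [t (f k) ja] and [t (f k.+1) ja]. The
   condition [k.+1 < b] puts both nodes below [ub], and by convexity [F] agrees with the branch to
   [ub] from [ua] on. *)
have mid k : (a <= k)%N -> (k.+1 < b)%N -> segsum F (w (f k)) =
    segsum (tree_between (t (f k) ja) (t (f k.+1) ja)) (w (f k)).
  move=> ak kb; apply: eq_segsum => s /wp/andP[ps sp].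
  have kb' : (k < b)%N by apply: ltnW.
  split=> [Fs|[ts st]].
    have sub : prefix s ub.
      apply: chain_prefix sF.1 Fs Fb _.
      by rewrite sb (leq_trans (ltnW sp))// pf.
    split.
      by apply: prefix_comparable (tb _ kb') sub _; rewrite szt.
    apply: prefix_comparable sub (tb _ kb) _.
    by rewrite szt (leq_trans (ltnW sp))// pf.
  apply: (sF.1.2 ua _ ub) => //.
    exact: prefix_trans (at_ _ ak kb') ts.
  exact: prefix_trans st (tb _ kb).
rewrite mid//; last by lia.
rewrite mid//; [|by lia..].
rewrite (le_trans (colV _ _ _ _ _ _ _))//; lra.
Qed.

End BlockSequence.

(** * Linear combinations together with their coefficient mass *)

Section Combinations.
Variables (R : realType) (V : normedModType R) (w : nat -> V).

(** The number [m] is the ell^1-mass of some representation of [y]. A relation is used because [y]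
    alone need not determine the coefficients. *)
Definition combo (lo hi : nat) (m : R) (y : V) := exists2 b : nat -> R,
  y = \sum_(lo <= n < hi) b n *: w n & m = \sum_(lo <= n < hi) `|b n|.

Lemma combo_zero (lo hi : nat) : combo lo hi 0 0.
Proof.
exists (fun=> 0); first by rewrite big1// => n _; rewrite scale0r.
by rewrite big1// => n _; rewrite normr0.
Qed.

Lemma combo_single (n : nat) (a : R) : combo n n.+1 `|a| (a *: w n).
Proof. by exists (fun=> a); rewrite big_nat1. Qed.

Lemma combo_cat (lo mid hi : nat) (m m' : R) (y y' : V) :
  (lo <= mid)%N -> (mid <= hi)%N ->
  combo lo mid m y -> combo mid hi m' y' -> combo lo hi (m + m') (y + y').
Proof.
move=> lm mh [b -> ->] [b' -> ->].
by exists (fun n => if (n < mid)%N then b n else b' n);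
  rewrite (big_cat_nat lm mh); congr (_ + _);
  rewrite [LHS]big_nat_cond [RHS]big_nat_cond; apply: eq_bigr => n;
  rewrite andbT => /andP[h1 h2]; rewrite ?h2// ltnNge h1.
Qed.

Lemma combo_pad (lo lo' hi hi' : nat) (m : R) (y : V) :
  (lo' <= lo)%N -> (lo <= hi)%N -> (hi <= hi')%N ->
  combo lo hi m y -> combo lo' hi' m y.
Proof.
move=> l lh h my; rewrite -[m]add0r -[y]add0r.
apply: combo_cat l _ (combo_zero _ _) _; first exact: leq_trans lh h.
rewrite -[m]addr0 -[y]addr0.
exact: combo_cat lh h my (combo_zero _ _).
Qed.

Lemma combo_scale (lo hi : nat) (a m : R) (y : V) :
  combo lo hi m y -> combo lo hi (`|a| * m) (a *: y).
Proof.
move=> [b -> ->]; exists (fun n => a * b n).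
  by rewrite scaler_sumr; apply: eq_bigr => n _; rewrite scalerA.
by rewrite mulr_sumr; apply: eq_bigr => n _; rewrite normrM.
Qed.

Lemma combo_norm (C : R) (lo hi : nat) (m : R) (y : V) :
  (forall n, `|w n| <= C) -> combo lo hi m y -> `|y| <= m * C.
Proof.
move=> wC [b -> ->]; rewrite (le_trans (ler_norm_sum _ _ _))// mulr_suml.
by apply: ler_sum => n _; rewrite normrZ ler_wpM2l.
Qed.

End Combinations.

(** * Bounded block sequences admit no lower ell^1-estimate *)

Section NoBlockBasis.
Variables (R : realType) (p : nat -> nat) (w : nat -> JT R) (C : R).
Hypothesis pS : forall n, (p n < p n.+1)%N.
Hypothesis wp : forall n s, w n s <> 0 -> (p n <= size s < p n.+1)%N.
Hypothesis wC : forall n, `|w n| <= C.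

Lemma combo_support (N : nat) (m : R) (y : JT R) (s : node) :
  combo w 0 N m y -> y s <> 0 -> (size s < p N)%N.
Proof.
move=> [b -> _]; elim: N => [|N IH]; first by rewrite big_nil.
rewrite big_nat_recr//= => h.
have [w0|/eqP/wp/andP[]//] := eqVneq (w N s) 0.
apply: (leq_trans (IH _)); last exact: ltnW.
set S : JT R := \sum_(0 <= n < N) b n *: w n => S0; apply: h.
by rewrite -[LHS]/(S s + b N * w N s) S0 w0 mulr0 addr0.
Qed.

Lemma sum_mem_le_size (N : nat) (E : seq nat) :
  (\sum_(i < N) (val i \in E) <= size E)%N.
Proof.
rewrite -(big_mkord xpredT (fun i => nat_of_bool (i \in E))).
rewrite (eq_bigr (fun i => if i \in E then 1 else 0)%N) => [|i _].
  2: by case: ifP.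
rewrite -big_mkcond sum1_count /index_iota subn0 -size_filter.
apply: uniq_leq_size.
  by rewrite filter_uniq// iota_uniq.
by move=> i; rewrite mem_filter => /andP[].
Qed.

(** A sum of [N] differences, taken beyond index [N0] with [e = d / 2], has mass [2 * N]. On any
    segment each difference contributes at most [d], except for four that contribute at most [2 * C]
    each. Dividing by the mass leaves [d / 2 + 4 * C / N]. *)
Lemma segment_null_combo (d : R) (N0 : nat) : 0 < d ->
  exists N y, [/\ (N0 <= N)%N, combo w N0 N 1 y &
    forall F, tree_segment F -> `|segsum F y| <= d].
Proof.
move=> d0; have C0 : 0 <= C by exact: le_trans (wC 0).
have [] := @alternating_subsequence R (fun n => p (N0 + n)%N)
    (fun n => w (N0 + n)%N) C _ _ _ (d / 2) _.
- by move=> n; rewrite addnS.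
- by move=> n s; rewrite addnS; exact: wp.
- by move=> n.
- by rewrite divr_gt0.
move=> f [fS hf]; pose g i := (N0 + f i)%N.
have gS i : (g i < g i.+1)%N by rewrite ltn_add2l.
pose y N : JT R := \sum_(i < N) (w (g i.*2) - w (g i.*2.+1)).
have yS n : y n.+1 = y n + (w (g n.*2) - w (g n.*2.+1)).
  by rewrite /y big_ord_recr.
have yc N : combo w N0 (g N.*2) (2 *+ N) (y N).
  elim: N => [|N IH].
    by rewrite /y big_ord0 mulr0n; exact: combo_zero.
  rewrite yS mulrSr doubleS.
  apply: combo_cat IH _; rewrite ?leq_addr//.
    by rewrite ltnW// (ltn_trans (gS _)).
  have -> : (2 : R) = `|1| + `|- 1| by rewrite normrN1 normr1.
  apply: (@combo_cat _ _ _ _ (g N.*2.+1)).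
  - exact/ltnW.
  - exact/ltnW.
  - rewrite -[X in combo _ _ _ _ X]scale1r.
    by apply: combo_pad (combo_single _ _ _).
  - rewrite -(scaleN1r (w _)).
    by apply: combo_pad (combo_single _ _ _).
(* This makes [N] exceed [8 * C / d], so that [4 * C / N] is below [d / 2]. *)
pose N := (Num.truncn (8 * C / d)).+1.
have N0' : 0 < N%:R :> R by rewrite ltr0n.
have yN F : tree_segment F -> `|segsum F (y N)| <= d * N%:R + 8 * C.
  move=> sF; have [E [sE hE]] := hf F sF.
  pose u i := `|segsum F (w (g i.*2)) - segsum F (w (g i.*2.+1))|.
  have h1 : `|segsum F (y N)| <= \sum_(i < N) u i.
    elim: N {N0'} => [|n IH].
      by rewrite /y !big_ord0 /segsum fsbig1// normr0.
    rewrite big_ord_recr yS JT_addE segsumD; last exact: sF.2.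
    rewrite (le_trans (ler_normD _ _))// lerD//.
    by rewrite JT_subE segsumB//; exact: sF.2.
  apply: le_trans h1 _.
  have h2 (i : 'I_N) : u i <= d + 2 * C * (val i \in E)%:R.
    case: (boolP (val i \in E)) => [_|/hE]; last first.
      by rewrite mulr0 addr0 mulrC divfK.
    rewrite mulr1 (le_trans (ler_normB _ _))//.
    have := segsum_le_norm (w (g i.*2)) sF; have := wC (g i.*2).
    have := segsum_le_norm (w (g i.*2.+1)) sF; have := wC (g i.*2.+1).
    lra.
  apply: le_trans (ler_sum _ (fun i _ => h2 i)) _.
  rewrite big_split/= sumr_const card_ord -[d *+ _]mulr_natr lerD2l -mulr_sumr.
  rewrite -natr_sum.
  have : (\sum_(i < N) (val i \in E))%:R <= 4 :> R.
    by rewrite ler_nat -sE sum_mem_le_size.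
  move=> h4; rewrite [leRHS](_ : _ = 2 * C * 4); last by ring.
  by rewrite ler_wpM2l// mulr_ge0.
exists (g N.*2), ((2 *+ N)^-1 *: y N); split.
- exact: leq_addr.
- rewrite [X in combo _ _ _ X _](_ : _ = `|(2 *+ N)^-1| * (2 *+ N)); last first.
    by rewrite ger0_norm ?invr_ge0 ?mulrn_wge0// mulVf// mulrn_eq0/= pnatr_eq0.
  exact: combo_scale.
move=> F sF; rewrite JT_scaleE segsumZ normrM normfV.
have -> : `|2 *+ N| = 2 * N%:R :> R by rewrite ger0_norm ?mulrn_wge0// mulr_natr.
rewrite ler_pdivrMl ?mulr_gt0// (le_trans (yN _ sF))//.
have : 8 * C / d < N%:R by exact: truncnS_gt.
rewrite ltr_pdivrMr// => h; lra.
Qed.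

(** Each new vector has mass 1 and norm at most [C], and its segment sums are made small only after
    [y] is known. The squared norm thus grows by at most [C ^+ 2], plus 1 for the cross terms. *)
Lemma slow_combo (m : nat) : exists N y, combo w 0 N m%:R y /\
  `|y| ^+ 2 <= m%:R * (C ^+ 2 + 1).
Proof.
elim: m => [|m [N [y [yc yle]]]].
  exists 0%N, 0; split; first exact: combo_zero.
  by rewrite normr0 expr0n/= mul0r.
pose k : R := #|{bseq (p N) of bool}|%:R.
have k0 : 0 <= k by rewrite ler0n.
(* With this [d] the cross terms total at most 1; the summand 1 keeps the inverse meaningful when
   [y] is zero. *)
pose d := (k * (2 * `|y|) + 1)^-1.
have K0 : 0 < k * (2 * `|y|) + 1 by rewrite ltr_wpDl// mulr_ge0// mulr_ge0.
have d0 : 0 < d by rewrite invr_gt0.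
have [N' [z [NN' zc zF]]] := segment_null_combo N d0.
exists N', (y + z); split; first by rewrite -natr1; exact: combo_cat yc zc.
apply: le_trans (norm_add_sqr (ltW d0) (fun s => @combo_support _ _ _ s yc) zF) _.
have zC : `|z| ^+ 2 <= C ^+ 2.
  have := combo_norm wC zc; rewrite mul1r => zC.
  by rewrite lerXn2r ?nnegrE// (le_trans _ zC).
have kd : k * (2 * `|y| * d) <= 1.
  by rewrite mulrA ler_pdivrMr// mul1r lerDl.
rewrite -natr1 mulrDl mul1r -/k; lra.
Qed.

Lemma no_ell1_block_basis (c : R) : 0 < c ->
  ~ forall N b, c * \sum_(0 <= n < N) `|b n| <=
                `|\sum_(0 <= n < N) b n *: w n|.
Proof.
(* The lower bound would force [c ^+ 2 * m <= C ^+ 2 + 1], which this [m] violates. *)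
move=> c0 low; pose m := (Num.truncn ((C ^+ 2 + 1) / c ^+ 2)).+1.
have [N [y [[b yE mE] yle]]] := slow_combo m.
have := low N b; rewrite -yE -mE => cm.
have : (c * m%:R) ^+ 2 <= m%:R * (C ^+ 2 + 1).
  apply: le_trans yle; rewrite lerXn2r ?nnegrE//.
  by rewrite mulr_ge0// ltW.
rewrite exprMn expr2 [m%:R ^+ 2]expr2 mulrCA ler_pM2l ?ltr0n//.
have := truncnS_gt ((C ^+ 2 + 1) / c ^+ 2); rewrite -/m.
rewrite ltr_pdivrMr ?exprn_gt0// expr2; lra.
Qed.

End NoBlockBasis.

(** * Unit vectors and normalized blocks in ell^1 *)

Section Ell1Vectors.
Variable R : realType.

Lemma ell1_norm_disjoint (x y : ell1 R) :
  (forall n, x n = 0 \/ y n = 0) -> `|x + y| = `|x| + `|y|.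
Proof.
move=> xy; apply: EFin_inj; rewrite EFinD -[LHS]ell1_sumE.
rewrite -[X in (X + _)%E]ell1_sumE -[X in (_ + X)%E]ell1_sumE.
rewrite /ell1_sum -nneseriesD => [|n _ _|n _ _]; rewrite ?lee_fin//.
apply: eq_eseriesr => n _; rewrite -EFinD; congr (_%:E).
rewrite [in LHS](_ : _ n = x n + y n)//.
by case: (xy n) => ->; rewrite ?normr0 ?add0r ?addr0.
Qed.

Definition unit_seq (j : nat) : nat -> R := fun n => (n == j)%:R.

Lemma unit_seq_sum (j : nat) : ell1_sum (unit_seq j) = 1%E.
Proof.
rewrite /ell1_sum (@nneseriesD1 _ _ j)// /unit_seq eqxx normr1 eseries0 ?adde0//.
by move=> n _ /andP[_ /negPf ->]; rewrite normr0.
Qed.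

Lemma unit_seq_pred (j : nat) : unit_seq j \in ell1_pred (R:=R).
Proof. by apply/ell1_predP; rewrite unit_seq_sum ltry. Qed.

Definition ell1_unit (j : nat) : ell1 R := Build_ell1 (unit_seq_pred j).

Lemma ell1_unit_norm (j : nat) : `|ell1_unit j| = 1.
Proof. by rewrite /Num.norm/= /ell1_norm unit_seq_sum. Qed.

Lemma block_support (m : nat -> nat) (v : nat -> ell1 R) (b : nat -> R)
    (N i : nat) :
  (forall n, m n <= m n.+1)%N ->
  (forall n i, v n i <> 0 -> (m n <= i < m n.+1)%N) ->
  (\sum_(0 <= n < N) b n *: v n) i <> 0 -> (i < m N)%N.
Proof.
move=> mS vm; elim: N => [|N IH]; first by rewrite big_nil.
rewrite big_nat_recr//=; set S : ell1 R := \sum_(0 <= n < N) _ => h.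
have [v0|/eqP/vm/andP[]//] := eqVneq (v N i) 0.
apply: leq_trans (mS N); apply: IH => S0; apply: h.
by rewrite -[LHS]/(S i + b N * v N i) v0 mulr0 addr0.
Qed.

Lemma block_norm (m : nat -> nat) (v : nat -> ell1 R) (b : nat -> R) (N : nat) :
  (forall n, m n <= m n.+1)%N ->
  (forall n i, v n i <> 0 -> (m n <= i < m n.+1)%N) ->
  (forall n, `|v n| = 1) ->
  `|\sum_(0 <= n < N) b n *: v n| = \sum_(0 <= n < N) `|b n|.
Proof.
move=> mS vm v1; elim: N => [|N IH]; first by rewrite !big_nil normr0.
rewrite !big_nat_recr//= -IH ell1_norm_disjoint ?normrZ ?v1 ?mulr1// => i.
have [iN|Ni] := ltnP i (m N); [right|left].
  have [v0|/eqP/vm/andP[]] := eqVneq (v N i) 0; last by rewrite leqNgt iN.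
  by rewrite -[LHS]/(b N * v N i) v0 mulr0.
apply: contrapT => /(block_support mS vm); by rewrite ltnNge Ni.
Qed.

(** There is one more vector than there are nodes of length at most [p], so the rows of values at
    these nodes are linearly dependent. A nonzero row of the left kernel, normalized, gives [a]. *)
Lemma vanishing_combination (p : nat) (k := #|{bseq p of bool}|.+1)
    (z : nat -> JT R) : exists a : nat -> R,
  \sum_(0 <= j < k) `|a j| = 1 /\
  forall s, (size s <= p)%N -> (\sum_(0 <= j < k) a j *: z j) s = 0.
Proof.
pose A : 'M[R]_(k, #|{bseq p of bool}|) :=
  \matrix_(j, i) z j (enum_val i : {bseq p of bool}).
have kerN0 : kermx A != 0.
  by rewrite -mxrank_eq0 mxrank_ker subn_eq0 -ltnNge ltnS rank_leq_col.
pose r := nz_row (kermx A).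
have rA : r *m A = 0 by apply/sub_kermxP/nz_row_sub.
have rN0 : r != 0 by rewrite nz_row_eq0.
pose c := \sum_(j < k) `|r 0 j|.
have c0 : 0 < c.
  have [j rj] : exists j, r 0 j != 0.
    apply/existsP; apply: contraR rN0 => /existsPn h.
    by apply/eqP/rowP => j; rewrite mxE; apply/eqP; rewrite -[_ == _]negbK h.
  rewrite /c (bigD1 j)//= ltr_pwDl ?normr_gt0//; exact: sumr_ge0.
pose a j := c^-1 * r 0 (inord j).
have aE (j : 'I_k) : a j = c^-1 * r 0 j by rewrite /a inord_val.
exists a; split.
  rewrite big_mkord (eq_bigr (fun j : 'I_k => c^-1 * `|r 0 j|)) => [|j _].
    by rewrite -mulr_sumr mulVf// gt_eqF.
  by rewrite aE normrM ger0_norm// invr_ge0 ltW.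
move=> s sp.
have -> : (\sum_(0 <= j < k) a j *: z j) s = \sum_(0 <= j < k) a j * z j s.
  have aux n : (\sum_(0 <= j < n) a j *: z j) s = \sum_(0 <= j < n) a j * z j s.
    elim: n => [|n IH]; first by rewrite !big_nil.
    by rewrite !big_nat_recr//= -IH.
  exact: aux.
rewrite big_mkord.
pose i := enum_rank (Bseq sp : {bseq p of bool}).
have := congr1 (fun M : 'rV[R]__ => M 0 i) rA.
rewrite !mxE => h; rewrite (eq_bigr (fun j : 'I_k => c^-1 * (r 0 j * z j s))).
  rewrite -mulr_sumr [X in _ * X](_ : _ = 0) ?mulr0// -[RHS]h.
  by apply: eq_bigr => j _; rewrite mxE enum_rankK.
by move=> j _; rewrite aE mulrA.
Qed.

Lemma unit_combination_support (m k : nat) (a : nat -> R) (i : nat) :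
  (\sum_(0 <= j < k) a j *: ell1_unit (m + j)) i <> 0 -> (m <= i < m + k)%N.
Proof.
elim: k => [|k IH]; first by rewrite big_nil.
rewrite big_nat_recr//=; set S : ell1 R := \sum_(0 <= j < k) _ => h.
have [->|ik] := eqVneq i (m + k)%N; first by rewrite leq_addr addnS ltnSn.
have /IH/andP[-> ik'] : S i <> 0.
  move=> S0; apply: h; rewrite -[LHS]/(S i + a k * (i == m + k)%N%:R).
  by rewrite S0 (negPf ik) mulr0 addr0.
by rewrite addnS ltnS ltnW.
Qed.

Lemma unit_combination_norm (m k : nat) (a : nat -> R) :
  `|\sum_(0 <= j < k) a j *: ell1_unit (m + j)| = \sum_(0 <= j < k) `|a j|.
Proof.
apply: (@block_norm (fun j => m + j)%N (fun j => ell1_unit (m + j))) => [n|n i|n].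
- by rewrite leq_add2l.
- rewrite -[X in X <> _]/((i == m + n)%N%:R).
  by case: eqP => //= ->; rewrite addnS leqnn ltnSn.
- exact: ell1_unit_norm.
Qed.

End Ell1Vectors.

(** * Passing from an embedding to a block sequence *)

Section Reduction.
Variables (R : realType) (T : {linear ell1 R -> JT R}).

(** A vanishing combination of fresh unit vectors clears the levels up to [p] of [T v], and
    truncation at a high level [q] removes the rest up to an error [e]. *)
Lemma block_step (e : R) (m p : nat) : 0 < e ->
  exists m' p' v y, [/\ (m <= m')%N, (p < p')%N,
    (forall i, (v : ell1 R) i <> 0 -> (m <= i < m')%N) /\ `|v| = 1,
    forall s, (y : JT R) s <> 0 -> (p <= size s < p')%N & `|T v - y| <= e].
Proof.
move=> e0.
have [a [a1 az]] :=
  vanishing_combination p (fun j => T (ell1_unit R (m + j))).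
set k := #|_|.+1 in a1 az.
pose v : ell1 R := \sum_(0 <= j < k) a j *: ell1_unit R (m + j).
have [q pq qe] := JT_trunc_approx (T v) p.+1 e0.
exists (m + k)%N, q, v, (JT_trunc q (T v)); split=> //.
- exact: leq_addr.
- split; first exact: unit_combination_support.
  by rewrite unit_combination_norm.
have Tv : T v = \sum_(0 <= j < k) a j *: T (ell1_unit R (m + j)).
  by rewrite /v linear_sum; apply: eq_bigr => j _; rewrite linearZ.
move=> s; rewrite -[X in X <> _]/(trunc q (T v) s) /trunc.
case: ltnP => // sq Ts; rewrite andbT leqNgt; apply/negP => /ltnW sp.
by apply: Ts; rewrite Tv az.
Qed.

Lemma block_sequence (e : R) : 0 < e ->
  exists (m p : nat -> nat) (v : nat -> ell1 R) (y : nat -> JT R), forall n,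
   [/\ (m n <= m n.+1)%N, (p n < p n.+1)%N,
    (forall i, v n i <> 0 -> (m n <= i < m n.+1)%N) /\ `|v n| = 1,
    forall s, y n s <> 0 -> (p n <= size s < p n.+1)%N & `|T (v n) - y n| <= e].
Proof.
move=> e0.
have /choice[f hf] (mp : nat * nat) : exists r : (nat * nat) * (ell1 R * JT R),
    [/\ (mp.1 <= r.1.1)%N, (mp.2 < r.1.2)%N,
    (forall i, r.2.1 i <> 0 -> (mp.1 <= i < r.1.1)%N) /\ `|r.2.1| = 1,
    forall s, r.2.2 s <> 0 -> (mp.2 <= size s < r.1.2)%N &
    `|T r.2.1 - r.2.2| <= e].
  have [m' [p' [v [y h]]]] := block_step mp.1 mp.2 e0.
  by exists ((m', p'), (v, y)).
pose s n := iter n (fun mp => (f mp).1) (0%N, 0%N).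
exists (fun n => (s n).1), (fun n => (s n).2), (fun n => (f (s n)).2.1),
  (fun n => (f (s n)).2.2) => n.
exact: hf.
Qed.

(** Replacing each [T (v n)] by a block within [c / 2] of it costs at most [c / 2] times the mass,
    so half of the lower bound survives for the blocks. *)
Lemma no_ell1_lower_bound (C c : R) : 0 < c ->
  (forall x, `|T x| <= C * `|x|) -> ~ forall x, c * `|x| <= `|T x|.
Proof.
move=> c0 TC Tc; have c20 : 0 < c / 2 by rewrite divr_gt0.
have [m [p [v [y /all_and5[mS pS /all_and2[vm v1] yp Ty]]]]] :=
  block_sequence c20.
have yC n : `|y n| <= C + c / 2.
  rewrite -[y n](subrK (T (v n))) addrC (le_trans (ler_normD _ _))// lerD//.
    by rewrite (le_trans (TC _))// v1 mulr1.
  by rewrite distrC.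
apply: (no_ell1_block_basis pS yp yC c20) => N b.
set S := \sum_(0 <= n < N) `|b n|; set Y := \sum_(0 <= n < N) b n *: y n.
pose V := \sum_(0 <= n < N) b n *: v n.
have VS : `|V| = S by exact: block_norm mS vm v1.
have TV : `|T V - Y| <= c / 2 * S.
  rewrite /V linear_sum -sumrB (le_trans (ler_norm_sum _ _ _))// mulr_sumr.
  by apply: ler_sum => n _; rewrite linearZ/= -scalerBr normrZ mulrC ler_wpM2r.
have := Tc V; rewrite VS => cS.
have : `|T V| <= `|T V - Y| + `|Y| by rewrite -{1}[T V](subrK Y) ler_normD.
lra.
Qed.

End Reduction.

(** * From a homeomorphism onto the image to two-sided norm bounds *)

Theorem theorem4p6 (R : realType) :
  ~ exists T : {linear ell1 R -> JT R}, homeomorphism_onto_image T.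
Proof.
move=> [T [/linear_bounded_continuous/linear_boundedP[C [_ TC]] [g Tg gc]]].
(* Boundedness is given for every constant above [C], hence for [C + 1]. *)
have {}TC x : `|T x| <= (C + 1) * `|x| by apply: TC; rewrite ltrDl.
have T0 : range T (0 : JT R) by exists 0 => //; exact: linear0.
(* Continuity of the inverse at 0 gives a radius [d] such that [|T x| < d] implies [|x| < 1]; by
   homogeneity [d / 2] is then a lower bound for [T], the halving making the inequality strict. *)
have : within (range T) (nbhs (0 : JT R)) [set y | `|g 0 - g y| < 1].
  rewrite (nbhs_subspace_in T0).
  by have := gc (0 : JT R) => /cvgrPdist_lt /(_ 1 ltr01).
move=> /nbhs_ballP[d /= d0 hd].
have low x : `|T x| < d -> `|x| < 1.
  move=> Tx; have := hd (T x); rewrite -ball_normE /= sub0r normrN => /(_ Tx).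
  move=> /(_ (imageT _ _)); rewrite Tg.
  have -> : g 0 = 0 by rewrite -(linear0 T) Tg.
  by rewrite sub0r normrN.
have d20 : 0 < d / 2 by rewrite divr_gt0.
apply: (@no_ell1_lower_bound R T _ (d / 2) d20 TC) => x.
rewrite leNgt; apply/negP => Tx.
have x0 : 0 < `|x|.
  rewrite normr_gt0; apply: contraL Tx => /eqP ->.
  by rewrite linear0 !normr0 mulr0 ltxx.
have : `|T (`|x|^-1 *: x)| < d.
  rewrite linearZ normrZ normfV normr_id ltr_pdivrMl//.
  rewrite (lt_le_trans Tx)// mulrC ler_wpM2l//; lra.
by move=> /low; rewrite normrZ normfV normr_id mulVf ?gt_eqF// ltxx.
Qed.
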